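(* Let $\mathfrak V$ be a subvariety of the variety $\mathfrak R$ of all right-symmetric $K$-algebras such that $\mathfrak V$ contains the variety $\mathfrak L$ of left-nilpotent of class $3$ algebras in $\mathfrak R$. Let $G\neq\langle 1\rangle$ be a subgroup of $GL_d(K)$ such that the ideal $F_d^2({\mathfrak L})^G$ of the algebra of invariants $F_d({\mathfrak L})^G$ is not finitely generated as a $K[(A_d)_1^G]$-module. Then the algebra of $G$-invariants $F_d({\mathfrak V})^G$ is not finitely generated (as a $K$-algebra).
   Context: $K$ is a field of characteristic $0$, $d\ge 2$ is an integer, and algebras are $K$-algebras, not necessarily associative or unital. A variety is the class of all algebras satisfying a given set of polynomial identities (elements of the absolutely free nonassociative algebra $K\{x_1,x_2,\ldots\}$). For a variety $\mathfrak V$, $F_d(\mathfrak V)$ is the relatively free algebra of $\mathfrak V$ of rank $d$, freely generated by $X_d=\{x_1,\ldots,x_d\}$, i.e. $K\{x_1,\ldots,x_d\}$ (without constant terms) modulo the polynomial identities of $\mathfrak V$ in $x_1,\ldots,x_d$. $\mathfrak R$ is the variety of right-symmetric algebras, defined by $(x_1,x_2,x_3)=(x_1,x_3,x_2)$, where $(x_1,x_2,x_3)=x_1(x_2x_3)-(x_1x_2)x_3$. $\mathfrak L$ is the subvariety of $\mathfrak R$ defined by the additional identity $x_1(x_2x_3)=0$. $GL_d(K)$ acts canonically on the vector space $KX_d$ with basis $X_d$, and this action is extended to $F_d(\mathfrak V)$ and to $K[X_d]=K[x_1,\ldots,x_d]$ by $g(f(x_1,\ldots,x_d))=f(g(x_1),\ldots,g(x_d))$,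 so that $GL_d(K)$ acts by algebra automorphisms. For a subgroup $G\le GL_d(K)$ and a $GL_d(K)$-module $M$, $M^G$ is the set of elements of $M$ fixed by all $g\in G$. $F_d^2(\mathfrak L)$ is the ideal of $F_d(\mathfrak L)$ of all elements without linear term (the square of $F_d(\mathfrak L)$), and $F_d^2(\mathfrak L)^G$ is its set of $G$-invariants. $F_d(\mathfrak L)$ has as basis the left-normed monomials $x_px_1^{n_1}\cdots x_d^{n_d}=(\cdots((x_px_1)x_1)\cdots)x_d$ with $p=1,\ldots,d$, $n_j\ge 0$ (where $x_p$ is multiplied on the right successively $n_1$ times by $x_1$, ..., $n_d$ times by $x_d$), and it is a right $K[X_d]$-module via $(x_px_1^{n_1}\cdots x_d^{n_d})\circ(x_1^{m_1}\cdots x_d^{m_d})=x_px_1^{n_1+m_1}\cdots x_d^{n_d+m_d}$; thus $f\circ x_j$ is the product $fx_j$ in $F_d(\mathfrak L)$. $F_d^2(\mathfrak L)$ is a $K[X_d]$-submodule. Put $(A_d)_1=KX_d$ and $(A_d)_1^G=(KX_d)^G$; $K[(A_d)_1^G]$ is the unital subalgebra of $K[X_d]$ generated by the linear polynomials fixed by $G$, and it acts on $F_d^2(\mathfrak L)^G$ by restriction of $\circ$. *)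

(* Defs.v *)
From HB Require Import structures.
From mathcomp Require Import all_boot all_algebra.
From mathcomp Require Import finmap boolp.
From mathcomp Require Import -(notations) monalg.
From mathcomp Require Import mpoly.

Set Implicit Arguments.
Unset Strict Implicit.
Unset Printing Implicit Defensive.

Import GRing.Theory.
Local Open Scope ring_scope.
Local Open Scope quotient_scope.

(* K-algebras, not necessarily associative or unital. *)
HB.mixin Record Lmodule_isNaAlg (K : fieldType) A of GRing.Lmodule K A := {
  namul : A -> A -> A;
  namulDl : forall x y z, namul (x + y) z = namul x z + namul y z;
  namulDr : forall x y z, namul x (y + z) = namul x y + namul x z;
  namulZl : forall a x y, namul (a *: x) y = a *: namul x y;
  namulZr : forall a x y, namul x (a *: y) = a *: namul x y
}.

#[short(type="naAlgType")]
HB.structure Definition NaAlg (K : fieldType) :=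
  { A of Lmodule_isNaAlg K A & GRing.Lmodule K A }.

Notation "x ** y" := (namul x y) (at level 40, left associativity) : ring_scope.

Local Notation "{ 'malg' R [ T ] }" := (@monalg.malg T R)
  (at level 0, R, T at level 2).
Local Notation "<< u >>" := (monalg.mkmalgU u 1) : ring_scope.

Section NaAlgTheory.
Variables (K : fieldType) (A : naAlgType K).
Implicit Types x y z : A.

Definition associator x y z : A := x ** (y ** z) - (x ** y) ** z.

Lemma namul0l y : 0 ** y = 0 :> A.
Proof. by have := namulZl 0 0 y; rewrite !scale0r. Qed.

Lemma namul0r y : y ** 0 = 0 :> A.
Proof. by have := namulZr 0 y 0; rewrite !scale0r. Qed.

Lemma namulBl x y z : (x - y) ** z = x ** z - y ** z.
Proof. by rewrite -(scaleN1r y) namulDl namulZl scaleN1r. Qed.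

Lemma namulBr x y z : x ** (y - z) = x ** y - x ** z.
Proof. by rewrite -(scaleN1r z) namulDr namulZr scaleN1r. Qed.

Lemma namul_suml I (r : seq I) (P : pred I) (F : I -> A) y :
  (\sum_(i <- r | P i) F i) ** y = \sum_(i <- r | P i) (F i ** y).
Proof. by apply: (big_morph (fun x => x ** y)) => [u v|]; rewrite ?namulDl ?namul0l. Qed.

Lemma namul_sumr I (r : seq I) (P : pred I) (F : I -> A) y :
  y ** (\sum_(i <- r | P i) F i) = \sum_(i <- r | P i) (y ** F i).
Proof. by apply: (big_morph (fun x => y ** x)) => [u v|]; rewrite ?namulDr ?namul0r. Qed.

(* The non-unital subalgebra of A generated by S. *)
Inductive na_subalg_gen (S : A -> Prop) : A -> Prop :=
| na_gen_in x : S x -> na_subalg_gen S x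
| na_gen_0 : na_subalg_gen S 0
| na_gen_D x y : na_subalg_gen S x -> na_subalg_gen S y -> na_subalg_gen S (x + y)
| na_gen_Z a x : na_subalg_gen S x -> na_subalg_gen S (a *: x)
| na_gen_M x y : na_subalg_gen S x -> na_subalg_gen S y -> na_subalg_gen S (x ** y).

Definition fg_algebra (B : A -> Prop) : Prop :=
  exists s : seq A, forall x, B x <-> na_subalg_gen (fun y => y \in s) x.

Definition na_square (x : A) : Prop :=
  exists s : seq (A * A), x = \sum_(ab <- s) ab.1 ** ab.2.

End NaAlgTheory.

Inductive magma (X : Type) := MVar of X | MMul of magma X & magma X.

Section MagmaChoice.
Variable X : Type.

Fixpoint magma_encode (u : magma X) : GenTree.tree X :=
  match u with
  | MVar x => GenTree.Leaf x
  | MMul v w => GenTree.Node 0 [:: magma_encode v; magma_encode w]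
  end.

Fixpoint magma_decode (t : GenTree.tree X) : option (magma X) :=
  match t with
  | GenTree.Leaf x => Some (MVar x)
  | GenTree.Node _ [:: v; w] =>
      if magma_decode v is Some v' then
        if magma_decode w is Some w' then Some (MMul v' w') else None
      else None
  | _ => None
  end.

Lemma magma_encodeK : pcancel magma_encode magma_decode.
Proof. by elim=> //= v -> w ->. Qed.

End MagmaChoice.

HB.instance Definition _ (X : choiceType) :=
  Choice.copy (magma X) (pcan_type (@magma_encodeK X)).

(* The linear map on the vector space with basis T that extends h. *)
HB.lock Definition lin_ext (K : fieldType) (T : choiceType) (M : lmodType K)
    (h : T -> M) (f : {malg K[T]}) : M :=
  \sum_(u <- monalg.msupp f) monalg.mcoeff u f *: h u.

Section LinearExtension.
Variables (K : fieldType) (T : choiceType).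

Lemma lin_extE (M : lmodType K) (h : T -> M) (f : {malg K[T]}) :
  lin_ext h f = \sum_(u <- monalg.msupp f) monalg.mcoeff u f *: h u.
Proof. by rewrite lin_ext.unlock. Qed.

Lemma lin_extEw (M : lmodType K) (h : T -> M) (f : {malg K[T]}) (D : {fset T}) :
  (monalg.msupp f `<=` D)%fset -> lin_ext h f = \sum_(u <- D) monalg.mcoeff u f *: h u.
Proof.
move=> sub; rewrite lin_extE (big_fset_incl _ sub) //= => u _ /monalg.mcoeff_outdom ->.
by rewrite scale0r.
Qed.

Lemma lin_ext_is_linear (M : lmodType K) (h : T -> M) : linear (lin_ext h).
Proof.
move=> a f g; pose D := (monalg.msupp f `|` monalg.msupp g `|` monalg.msupp (a *: f + g))%fset.
have Df : (monalg.msupp f `<=` D)%fset by apply: fsubset_trans (fsubsetUl _ _); exact: fsubsetUl.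
have Dg : (monalg.msupp g `<=` D)%fset by apply: fsubset_trans (fsubsetUl _ _); exact: fsubsetUr.
rewrite (lin_extEw h Df) (lin_extEw h Dg) (@lin_extEw _ h _ D) ?fsubsetUr //.
rewrite scaler_sumr -big_split /=; apply: eq_bigr => u _.
by rewrite monalg.mcoeffD monalg.mcoeffZ scalerDl scalerA.
Qed.

HB.instance Definition _ (M : lmodType K) (h : T -> M) :=
  GRing.isLinear.Build K {malg K[T]} M *:%R (lin_ext h) (lin_ext_is_linear h).

Lemma lin_extU (M : lmodType K) (h : T -> M) u : lin_ext h << u >> = h u.
Proof. by rewrite lin_extE monalg.msuppU oner_eq0 big_seq_fset1 monalg.mcoeffUU scale1r. Qed.

Lemma lin_ext_comp (M N : lmodType K) (h : T -> M) (k : {linear M -> N}) f :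
  k (lin_ext h f) = lin_ext (k \o h) f.
Proof. by rewrite !lin_extE linear_sum; apply: eq_bigr => u _; rewrite linearZ. Qed.

Lemma lin_ext_id (f : {malg K[T]}) : lin_ext (fun u => << u >> : {malg K[T]}) f = f.
Proof.
rewrite lin_extE [RHS]monalg.monalgE; apply: eq_bigr => u _.
by apply/monalg.malgP => v; rewrite monalg.mcoeffZ !monalg.mcoeffU mulr_natr.
Qed.

Lemma eq_lin_ext (M : lmodType K) (h k : T -> M) : h =1 k -> lin_ext h =1 lin_ext k.
Proof. by move=> e f; rewrite !lin_extE; apply: eq_bigr => u _; rewrite e. Qed.

End LinearExtension.

(* The absolutely free algebra K{X} without constant terms: the vector space
   with basis the free magma on X. *)
Definition naPoly (K : fieldType) (X : choiceType) := {malg K[magma X]}.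

HB.instance Definition _ (K : fieldType) (X : choiceType) :=
  GRing.Lmodule.on (naPoly K X).

HB.lock Definition var (K : fieldType) (X : choiceType) (x : X) : naPoly K X :=
  << MVar x >>.

HB.lock Definition naPoly_mul (K : fieldType) (X : choiceType) (f g : naPoly K X) :
    naPoly K X :=
  lin_ext (fun u => lin_ext (fun v => << MMul u v >> : naPoly K X) g) f.

Section NaPoly.
Variables (K : fieldType) (X : choiceType).
Implicit Types f g : naPoly K X.

Lemma naPoly_mulDl f1 f2 g :
  naPoly_mul (f1 + f2) g = naPoly_mul f1 g + naPoly_mul f2 g :> naPoly K X.
Proof. rewrite naPoly_mul.unlock; exact: linearD. Qed.

Lemma naPoly_mulZl a f g : naPoly_mul (a *: f) g = a *: naPoly_mul f g.
Proof. rewrite naPoly_mul.unlock; exact: linearZ. Qed.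

Lemma naPoly_mulDr f g1 g2 :
  naPoly_mul f (g1 + g2) = naPoly_mul f g1 + naPoly_mul f g2.
Proof.
rewrite naPoly_mul.unlock !(lin_extE _ f) -big_split; apply: eq_bigr => u _.
by rewrite linearD scalerDr.
Qed.

Lemma naPoly_mulZr a f g : naPoly_mul f (a *: g) = a *: naPoly_mul f g.
Proof.
rewrite naPoly_mul.unlock !(lin_extE _ f) scaler_sumr; apply: eq_bigr => u _.
by rewrite linearZ /= !scalerA mulrC.
Qed.

HB.instance Definition _ := Lmodule_isNaAlg.Build K (naPoly K X)
  naPoly_mulDl naPoly_mulDr naPoly_mulZl naPoly_mulZr.

Section Evaluation.
Variables (A : naAlgType K) (phi : X -> A).

Fixpoint meval (u : magma X) : A :=
  match u with
  | MVar x => phi x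
  | MMul v w => meval v ** meval w
  end.

Definition peval (f : naPoly K X) : A := lin_ext meval f.

HB.instance Definition _ :=
  GRing.isLinear.Build K (naPoly K X) A *:%R peval (lin_ext_is_linear meval).

Lemma peval_var x : peval (var K x) = phi x.
Proof. by rewrite var.unlock; exact: lin_extU. Qed.

Lemma pevalM f g : peval (f ** g) = peval f ** peval g.
Proof.
rewrite -[f ** g]/(naPoly_mul f g) naPoly_mul.unlock.
rewrite lin_ext_comp /peval lin_extE [in RHS](lin_extE _ f) namul_suml.
apply: eq_bigr => u _; rewrite namulZl; congr (_ *: _); rewrite /= lin_ext_comp.
rewrite lin_extE (lin_extE _ g) namul_sumr; apply: eq_bigr => v _.
by rewrite namulZr /= /peval lin_extU.
Qed.

Lemma pevalB f g : peval (f - g) = peval f - peval g.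
Proof. exact: linearB. Qed.

Lemma peval_associator f g h :
  peval (associator f g h) = associator (peval f) (peval g) (peval h).
Proof. by rewrite /associator pevalB !pevalM. Qed.

End Evaluation.
End NaPoly.

Lemma peval_id (K : fieldType) (X : choiceType) (f : naPoly K X) :
  peval (@var K X) f = f.
Proof.
rewrite -[RHS]lin_ext_id; apply: eq_lin_ext; elim=> [x|v IHv w IHw] /=; first by rewrite var.unlock.
rewrite IHv IHw -[LHS]/(naPoly_mul _ _) naPoly_mul.unlock lin_extU; exact: lin_extU.
Qed.

Lemma eq_peval (K : fieldType) (X : choiceType) (A : naAlgType K) (phi psi : X -> A) :
  phi =1 psi -> peval phi =1 peval psi.
Proof.
by move=> e; apply: eq_lin_ext; elim=> [y|v IHv w IHw] /=; rewrite ?e // IHv IHw.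
Qed.

Lemma peval_comp (K : fieldType) (X : choiceType) (A B : naAlgType K)
    (k : {linear A -> B}) (kM : forall x y, k (x ** y) = k x ** k y)
    (phi : X -> A) (f : naPoly K X) :
  k (peval phi f) = peval (k \o phi) f.
Proof.
rewrite /peval lin_ext_comp; apply: eq_lin_ext => u /=.
by elim: u => //= v <- w <-; rewrite kM.
Qed.

Section Varieties.
Variable K : fieldType.

Definition variety_of (Sigma : naPoly K nat -> Prop) (A : naAlgType K) : Prop :=
  forall f, Sigma f -> forall phi : nat -> A, peval phi f = 0.

Definition is_variety (V : naAlgType K -> Prop) : Prop :=
  exists Sigma, forall A, V A <-> variety_of Sigma A.

Lemma variety_of_is_variety Sigma : is_variety (variety_of Sigma).
Proof. by exists Sigma. Qed.

Definition right_symmetric_id : naPoly K nat :=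
  associator (var K 1%N) (var K 2%N) (var K 3%N) - associator (var K 1%N) (var K 3%N) (var K 2%N).

Definition left_nilpotent3_id : naPoly K nat := var K 1%N ** (var K 2%N ** var K 3%N).

Definition variety_R : naAlgType K -> Prop :=
  variety_of (fun f => f = right_symmetric_id).

Definition variety_L : naAlgType K -> Prop :=
  variety_of (fun f => f = right_symmetric_id \/ f = left_nilpotent3_id).

Lemma variety_RP (A : naAlgType K) :
  variety_R A <-> forall a b c : A, associator a b c = associator a c b.
Proof.
split=> [RA a b c|RA f -> phi]; last first.
  by rewrite pevalB !peval_associator !peval_var RA subrr.
have := RA _ erefl (fun n => nth a [:: a; a; b; c] n).
rewrite pevalB !peval_associator !peval_var /=.
by move/eqP; rewrite subr_eq0 => /eqP.
Qed.

Lemma variety_LP (A : naAlgType K) :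
  variety_L A <-> variety_R A /\ forall a b c : A, a ** (b ** c) = 0.
Proof.
split=> [LA|[RA NA] f [->|->] phi]; last 2 first.
- exact: RA.
- by rewrite !pevalM !peval_var NA.
split=> [f Rf phi|a b c]; first by apply: LA; left.
have := LA _ (or_intror erefl) (fun n => nth a [:: a; a; b; c] n).
by rewrite !pevalM !peval_var.
Qed.

End Varieties.

Section Identities.
Variables (K : fieldType) (V : naAlgType K -> Prop) (X : choiceType).

Definition identity_of (f : naPoly K X) : Prop :=
  forall A, V A -> forall phi : X -> A, peval phi f = 0.

Definition identities : {pred naPoly K X} := fun f => `[< identity_of f >].

Lemma identitiesP f : reflect (identity_of f) (f \in identities).
Proof. exact: asboolP. Qed.

Lemma identities_zmod_closed : zmod_closed identities.
Proof.
split; first by apply/identitiesP => A _ phi; rewrite linear0.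
move=> f g /identitiesP fI /identitiesP gI; apply/identitiesP => A VA phi.
by rewrite linearB /= fI // gI // subr0.
Qed.

HB.instance Definition _ :=
  GRing.isZmodClosed.Build (naPoly K X) identities identities_zmod_closed.

Lemma identitiesZ a f : f \in identities -> a *: f \in identities.
Proof.
by move=> /identitiesP fI; apply/identitiesP => A VA phi; rewrite linearZ /= fI ?scaler0.
Qed.

Lemma identitiesMl f g : f \in identities -> f ** g \in identities.
Proof.
by move=> /identitiesP fI; apply/identitiesP => A VA phi; rewrite pevalM fI ?namul0l.
Qed.

Lemma identitiesMr f g : g \in identities -> f ** g \in identities.
Proof.
by move=> /identitiesP gI; apply/identitiesP => A VA phi; rewrite pevalM gI ?namul0r.
Qed.

End Identities.

(* The relatively free algebra F_X(V). *)
Definition relfree (K : fieldType) (V : naAlgType K -> Prop) (X : choiceType) : Type :=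
  Quotient.quot (@identities K V X).

HB.instance Definition _ (K : fieldType) (V : naAlgType K -> Prop) (X : choiceType) :=
  GRing.Zmodule.on (relfree V X).

HB.lock Definition relfree_pi (K : fieldType) (V : naAlgType K -> Prop) (X : choiceType)
    (f : naPoly K X) : relfree V X :=
  \pi_(Quotient.quot (@identities K V X)) f.

HB.lock Definition relfree_repr (K : fieldType) (V : naAlgType K -> Prop) (X : choiceType)
    (f : relfree V X) : naPoly K X :=
  repr (f : Quotient.quot (@identities K V X)).

Section RelativelyFree.
Variables (K : fieldType) (V : naAlgType K -> Prop) (X : choiceType).

Local Notation relfree := (@relfree K V X).
Local Notation pi := (@relfree_pi K V X).
Local Notation rep := (@relfree_repr K V X).
Local Notation identities := (@identities K V X).

Lemma relfree_reprK : cancel rep pi.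
Proof. by move=> f; rewrite relfree_pi.unlock relfree_repr.unlock reprK. Qed.

Lemma relfree_piP f g : pi f = pi g <-> f - g \in identities.
Proof. by rewrite relfree_pi.unlock Quotient.idealrBE; split=> [/eqP|/eqP]. Qed.

Lemma repr_piP f : rep (pi f) - f \in identities.
Proof. by apply/relfree_piP; rewrite relfree_reprK. Qed.

Lemma relfree_pi_is_zmod_morphism : zmod_morphism pi.
Proof. by rewrite relfree_pi.unlock; exact: pi_is_zmod_morphism. Qed.

HB.instance Definition _ :=
  GRing.isZmodMorphism.Build (naPoly K X) relfree pi
    relfree_pi_is_zmod_morphism.

Definition relfree_scale (a : K) (f : relfree) : relfree :=
  pi (a *: rep f).

Definition relfree_mul (f g : relfree) : relfree :=
  pi (rep f ** rep g).

Lemma relfree_pi_scale a f : relfree_scale a (pi f) = pi (a *: f).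
Proof. by apply/relfree_piP; rewrite -scalerBr identitiesZ ?repr_piP. Qed.

Lemma relfree_pi_mul f g :
  relfree_mul (pi f) (pi g) = pi (f ** g).
Proof.
apply/relfree_piP; set f' := rep _; set g' := rep _.
have -> : f' ** g' - f ** g = (f' - f) ** g' + f ** (g' - g).
  by rewrite namulBl namulBr addrA subrK.
by apply: rpredD; [apply: identitiesMl | apply: identitiesMr]; apply: repr_piP.
Qed.

Lemma relfree_scaleA a b f : relfree_scale a (relfree_scale b f) = relfree_scale (a * b) f.
Proof. by rewrite -(relfree_reprK f) !relfree_pi_scale scalerA. Qed.

Lemma relfree_scale1 : left_id 1 relfree_scale.
Proof. by move=> f; rewrite -(relfree_reprK f) relfree_pi_scale scale1r. Qed.

Lemma relfree_scaleDr : right_distributive relfree_scale +%R.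
Proof.
move=> a f g; rewrite -(relfree_reprK f) -(relfree_reprK g) -raddfD.
by rewrite !relfree_pi_scale scalerDr raddfD.
Qed.

Lemma relfree_scaleDl f : {morph relfree_scale^~ f : a b / a + b}.
Proof.
by move=> a b; rewrite -(relfree_reprK f) !relfree_pi_scale scalerDl raddfD.
Qed.

HB.instance Definition _ := GRing.Zmodule_isLmodule.Build K relfree
  relfree_scaleA relfree_scale1 relfree_scaleDr relfree_scaleDl.

Lemma relfree_mulDl f g h : relfree_mul (f + g) h = relfree_mul f h + relfree_mul g h.
Proof.
rewrite -(relfree_reprK f) -(relfree_reprK g) -(relfree_reprK h) -raddfD.
by rewrite !relfree_pi_mul namulDl raddfD.
Qed.

Lemma relfree_mulDr f g h : relfree_mul f (g + h) = relfree_mul f g + relfree_mul f h.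
Proof.
rewrite -(relfree_reprK f) -(relfree_reprK g) -(relfree_reprK h) -raddfD.
by rewrite !relfree_pi_mul namulDr raddfD.
Qed.

Lemma relfree_mulZl a f g : relfree_mul (a *: f) g = a *: relfree_mul f g.
Proof.
rewrite -(relfree_reprK f) -(relfree_reprK g) /GRing.scale /=.
by rewrite relfree_pi_scale !relfree_pi_mul relfree_pi_scale namulZl.
Qed.

Lemma relfree_mulZr a f g : relfree_mul f (a *: g) = a *: relfree_mul f g.
Proof.
rewrite -(relfree_reprK f) -(relfree_reprK g) /GRing.scale /=.
by rewrite relfree_pi_scale !relfree_pi_mul relfree_pi_scale namulZr.
Qed.

HB.instance Definition _ := Lmodule_isNaAlg.Build K relfree
  relfree_mulDl relfree_mulDr relfree_mulZl relfree_mulZr.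

Lemma relfree_pi_is_scalable : scalable pi.
Proof. by move=> a f; rewrite -relfree_pi_scale. Qed.

HB.instance Definition _ :=
  GRing.isScalable.Build K (naPoly K X) relfree *:%R pi
    relfree_pi_is_scalable.

Lemma relfree_piM f g : pi (f ** g) = pi f ** pi g.
Proof. by rewrite -relfree_pi_mul. Qed.

Definition relfree_var (x : X) : relfree := pi (var K x).

Lemma peval_relfree_var f : peval relfree_var f = pi f.
Proof.
have -> : peval relfree_var f = pi (peval (@var K X) f).
  by rewrite (peval_comp relfree_piM).
by rewrite peval_id.
Qed.

Lemma relfree_identity (Y : choiceType) (f : naPoly K Y) (phi : Y -> relfree) :
  (forall A, V A -> forall psi : Y -> A, peval psi f = 0) -> peval phi f = 0.
Proof.
move=> fI; pose q y := rep (phi y).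
have -> : peval phi f = pi (peval q f).
  by rewrite (peval_comp relfree_piM); apply: eq_peval => y /=; rewrite relfree_reprK.
rewrite -(raddf0 pi); apply/relfree_piP; rewrite subr0.
apply/identitiesP => A VA psi.
by rewrite (peval_comp (pevalM psi)) fI.
Qed.

(* f(x_1, x_2, ...) |-> f(y_1, y_2, ...); the value does not depend on the chosen
   representative by relfree_subst_pi. *)
Definition relfree_subst (y : X -> relfree) (f : relfree) : relfree :=
  peval y (rep f).

Lemma relfree_subst_pi y f : relfree_subst y (pi f) = peval y f.
Proof.
apply/eqP; rewrite -subr_eq0 -linearB /=; apply/eqP.
by apply: relfree_identity; apply/identitiesP; exact: repr_piP.
Qed.

Lemma relfree_subst_is_linear y : linear (relfree_subst y).
Proof.
move=> a f g; rewrite -(relfree_reprK f) -(relfree_reprK g).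
by rewrite -[in LHS](linearP pi) !relfree_subst_pi linearP.
Qed.

HB.instance Definition _ y := GRing.isLinear.Build K relfree relfree *:%R
  (relfree_subst y) (relfree_subst_is_linear y).

Lemma relfree_substM y f g :
  relfree_subst y (f ** g) = relfree_subst y f ** relfree_subst y g.
Proof.
rewrite -(relfree_reprK f) -(relfree_reprK g) -relfree_piM.
by rewrite !relfree_subst_pi pevalM.
Qed.

Lemma eq_relfree_subst y z : y =1 z -> relfree_subst y =1 relfree_subst z.
Proof. by move=> e f; exact: eq_peval. Qed.

Lemma relfree_subst_id f : relfree_subst relfree_var f = f.
Proof. by rewrite -[RHS]relfree_reprK -peval_relfree_var. Qed.

Lemma relfree_subst_comp y z f :
  relfree_subst y (relfree_subst z f) = relfree_subst (relfree_subst y \o z) f.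
Proof. exact: (peval_comp (relfree_substM y) z (rep f)). Qed.

Lemma relfree_subst_var y x : relfree_subst y (relfree_var x) = y x.
Proof. by rewrite relfree_subst_pi peval_var. Qed.

End RelativelyFree.

Lemma relfree_variety (K : fieldType) (V : naAlgType K -> Prop) (X : choiceType) :
  is_variety V -> V (relfree V X).
Proof.
move=> [S VS]; apply/VS => f Sf phi; apply: relfree_identity => A /VS VA psi.
exact: VA.
Qed.

(* A subgroup of GL_d(K), which is infinite here, given by its elements. *)
Definition GL_subgroup (K : fieldType) (d : nat) (G : 'M[K]_d -> Prop) : Prop :=
  [/\ forall g, G g -> g \in unitmx,
      G 1%:M,
      forall g h, G g -> G h -> G (g *m h) &
      forall g, G g -> G (invmx g)].

(* The action of g on the vectors x_1, ..., x_d: the matrix acts on coordinate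
   columns, so g(x_j) is the combination given by its j-th column. *)
Definition GL_vect (K : fieldType) (d : nat) (M : lmodType K) (x : 'I_d -> M)
    (g : 'M[K]_d) (j : 'I_d) : M :=
  \sum_(i < d) g i j *: x i.

Section Invariants.
Variables (K : fieldType) (d : nat) (G : 'M[K]_d -> Prop).

Definition GL_act (V : naAlgType K -> Prop) (g : 'M[K]_d) :
    relfree V 'I_d -> relfree V 'I_d :=
  relfree_subst (GL_vect (@relfree_var K V 'I_d) g).

Definition GL_act_poly (g : 'M[K]_d) (p : {mpoly K[d]}) : {mpoly K[d]} :=
  p \mPo [tuple GL_vect (fun i => 'X_i : {mpoly K[d]}) g j | j < d].

Lemma GL_act1 V f : GL_act 1%:M f = f :> relfree V 'I_d.
Proof.
rewrite -[RHS]relfree_subst_id; apply: eq_relfree_subst => j.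
rewrite /GL_vect (bigD1 j) //= mxE eqxx scale1r big1 ?addr0 // => i /negPf ij.
by rewrite mxE ij scale0r.
Qed.

Lemma GL_actM V g h f : GL_act (g *m h) f = GL_act g (GL_act h f) :> relfree V 'I_d.
Proof.
rewrite /GL_act [RHS]relfree_subst_comp; apply: eq_relfree_subst => j /=.
rewrite /GL_vect linear_sum.
under [RHS]eq_bigr => k _ do rewrite linearZ /= relfree_subst_var scaler_sumr.
rewrite exchange_big; apply: eq_bigr => i _; rewrite mxE scaler_suml.
by apply: eq_bigr => k _; rewrite scalerA mulrC.
Qed.

Definition invariants (V : naAlgType K -> Prop) (f : relfree V 'I_d) : Prop :=
  forall g, G g -> GL_act g f = f.

(* F_d^2(V)^G: the products of two elements span F_d^2(V), i.e. the elements
   without linear term. *)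
Definition square_invariants (V : naAlgType K -> Prop) (f : relfree V 'I_d) : Prop :=
  na_square f /\ invariants f.

Definition linear_invariants (p : {mpoly K[d]}) : Prop :=
  p \is 1.-homog /\ forall g, G g -> GL_act_poly g p = p.

(* The unital subalgebra K[(A_d)_1^G] of K[X_d]. *)
Inductive linear_invariant_alg : {mpoly K[d]} -> Prop :=
| lia_in p : linear_invariants p -> linear_invariant_alg p
| lia_1 : linear_invariant_alg 1
| lia_D p q : linear_invariant_alg p -> linear_invariant_alg q ->
    linear_invariant_alg (p + q)
| lia_Z a p : linear_invariant_alg p -> linear_invariant_alg (a *: p)
| lia_M p q : linear_invariant_alg p -> linear_invariant_alg q ->
    linear_invariant_alg (p * q).

End Invariants.

Section RightAction.
Variables (K : fieldType) (d : nat).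

Local Notation F := (relfree (@variety_L K) 'I_d).
Local Notation x := (@relfree_var K (@variety_L K) 'I_d).

(* (... ((f x_1) x_1) ...) x_d: multiply m_1 times by x_1, ..., m_d times by x_d *)
Definition rmul_monom (f : F) (m : 'X_{1..d}) : F :=
  foldl (fun h i => iter (m i) (fun h' => h' ** x i) h) f (enum 'I_d).

Definition ract (f : F) (p : {mpoly K[d]}) : F :=
  \sum_(m <- msupp p) p@_m *: rmul_monom f m.

Lemma rmul_comm (f : F) i j : f ** x i ** x j = f ** x j ** x i.
Proof.
have LF : variety_L F by apply: relfree_variety; exact: variety_of_is_variety.
have [/variety_RP FR FL] := proj1 (variety_LP _) LF.
have := FR f (x i) (x j); rewrite /associator !FL !sub0r.
by move/oppr_inj.
Qed.

Lemma ractX f m : ract f 'X_[m] = rmul_monom f m.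
Proof. by rewrite /ract msuppX big_seq1 mcoeffX eqxx scale1r. Qed.

Lemma ractEw f p (r : seq 'X_{1..d}) : uniq r -> {subset msupp p <= r} ->
  ract f p = \sum_(m <- r) p@_m *: rmul_monom f m.
Proof.
move=> Ur sub; rewrite [RHS](bigID (mem (msupp p))) /= [X in _ + X]big1 ?addr0; last first.
  by move=> m /memN_msupp_eq0 ->; rewrite scale0r.
rewrite -big_filter; apply: perm_big; apply: uniq_perm => //.
- exact: filter_uniq.
- by move=> m; rewrite mem_filter; case: (boolP (m \in msupp p)) => // /sub ->.
Qed.

Lemma ract_linear f : linear (ract f).
Proof.
move=> a p q; pose r := undup (msupp p ++ msupp q ++ msupp (a *: p + q)).
have Ur : uniq r by exact: undup_uniq.
rewrite !(@ractEw _ _ r) //;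
  try by move=> m mP; rewrite mem_undup !mem_cat mP ?orbT.
rewrite scaler_sumr -big_split; apply: eq_bigr => m _ /=.
by rewrite mcoeffD mcoeffZ scalerDl scalerA.
Qed.

Lemma rmul_monomD f m n : rmul_monom (rmul_monom f m) n = rmul_monom f (m + n)%MM.
Proof.
have itC k i j h : iter k (fun h => h ** x i) (h ** x j) =
    iter k (fun h => h ** x i) h ** x j.
  by elim: k => //= k ->; rewrite rmul_comm.
have itCC k l i j h : iter k (fun h => h ** x i) (iter l (fun h => h ** x j) h) =
    iter l (fun h => h ** x j) (iter k (fun h => h ** x i) h).
  by elim: l => //= l <-; rewrite itC.
rewrite /rmul_monom; elim: (enum 'I_d) f => //= i s IH f.
rewrite mnmDE addnC iterD -IH; congr foldl.
elim: s (iter (m i) _ f) {IH} => //= j s IH h.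
by rewrite IH itCC.
Qed.

(* On the left-normed basis monomials, ract is given by
   (x_p X^n) o X^m = x_p X^(n + m). *)
Lemma ract_monom (p : 'I_d) (n m : 'X_{1..d}) :
  ract (rmul_monom (x p) n) 'X_[m] = rmul_monom (x p) (n + m)%MM.
Proof. by rewrite ractX rmul_monomD. Qed.

End RightAction.

(* N is generated by finitely many of its elements as a module over B. *)
Definition fg_module (K : fieldType) (d : nat) (B : {mpoly K[d]} -> Prop)
    (N : relfree (@variety_L K) 'I_d -> Prop) : Prop :=
  exists s : seq (relfree (@variety_L K) 'I_d),
    (forall h, h \in s -> N h) /\
    forall f, N f -> exists p : 'I_(size s) -> {mpoly K[d]},
      (forall i, B (p i)) /\ f = \sum_(i < size s) ract s`_i (p i).

(* Main.v *)
Require Import Defs.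
From HB Require Import structures.
From mathcomp Require Import all_boot all_algebra.
From mathcomp Require Import mpoly.

(** Write F(V) and F(L) for the relatively free algebras of rank d. The proof
    reduces finite generation of F(V)^G first to finite generation of F(L)^G,
    and then to finite generation of the module F^2(L)^G.

    The first reduction needs every G-invariant of F(L) to lift to a
    G-invariant of F(V), for an arbitrary subgroup G. This holds because the
    canonical map F(V) -> F(L) has a GL_d-equivariant linear section, which
    in characteristic 0 can be written down instead of being derived from
    complete reducibility: it sends x_p x_{i_1} ... x_{i_k} to the average
    over the permutations s of the left-normed products
    x_p x_{i_s(1)} ... x_{i_s(k)}. The average is organised recursively as a
    Taylor expansion. On F(L) there are partial derivatives D_i, which
    differentiate a left-normed monomial in all of its letters but the first,
    and the component of degree n + 2 of f is obtained from that of degree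
    n + 1 of the D_i f by Euler's formula
        T_{n+1} f = (n + 1)^-1 sum_i (T_n (D_i f)) x_i,
    where T_0 takes the linear part. The products with x_i can be evaluated in
    any algebra (taylor). Since sum_i D_i (x) x_i is invariant under GL_d, the
    expansion is equivariant (taylor_GL); on F(L) it recovers f
    (taylor_sum). Both together give invariants_lift.

    The second reduction (fg_square_invariants) uses that in F(L) a product
    f h depends only on f and on the linear part of h, and is the action on f
    of that linear part. Hence, if t_1, ..., t_m generate the algebra F(L)^G,
    every product of invariants is obtained from the products t_i t_j by the
    action of invariant linear forms, and so F^2(L)^G is generated as a module
    by the t_i t_j and by the t_i minus their linear parts. *)

Set Implicit Arguments.
Unset Strict Implicit.
Unset Printing Implicit Defensive.

Import GRing.Theory.
Local Open Scope ring_scope.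

(** * The universal property of relatively free algebras *)
Section RelfreeEval.
Variables (K : fieldType) (V : naAlgType K -> Prop) (X : choiceType).
Local Notation F := (relfree V X).
Local Notation x := (@relfree_var K V X).

Lemma relfree_ind (P : F -> Prop) :
  (forall i, P (x i)) -> P 0 -> (forall f g, P f -> P g -> P (f + g)) ->
  (forall a f, P f -> P (a *: f)) -> (forall f g, P f -> P g -> P (f ** g)) ->
  forall f, P f.
Proof.
move=> Px P0 PD PZ PM f; rewrite -[f]relfree_subst_id /relfree_subst /peval lin_extE.
apply: big_ind => // u _; apply: PZ; elim: u => [i|u IHu v IHv] /=; first exact: Px.
exact: PM.
Qed.

(** The membership proof is an argument so that linearity and multiplicativity,
    which hold only for algebras of the variety, attach to the function. *)
Definition relfree_eval (A : naAlgType K) (VA : V A) (phi : X -> A) (f : F) : A :=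
  peval phi (relfree_repr f).

Section Eval.
Variables (A : naAlgType K) (VA : V A) (phi : X -> A).
Local Notation ev := (relfree_eval VA phi).

Lemma relfree_eval_pi f : ev (relfree_pi V f) = peval phi f.
Proof.
apply/eqP; rewrite -subr_eq0 -linearB /=; apply/eqP.
by have /identitiesP := repr_piP V f; apply.
Qed.

Lemma relfree_eval_is_linear : linear ev.
Proof.
move=> a f g; rewrite -(relfree_reprK f) -(relfree_reprK g).
by rewrite -[in LHS]linearP !relfree_eval_pi linearP.
Qed.

HB.instance Definition _ :=
  GRing.isLinear.Build K F A *:%R ev relfree_eval_is_linear.

Lemma relfree_evalM f g : ev (f ** g) = ev f ** ev g.
Proof.
rewrite -(relfree_reprK f) -(relfree_reprK g) -relfree_piM.
by rewrite !relfree_eval_pi pevalM.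
Qed.

Lemma relfree_eval_var i : ev (x i) = phi i.
Proof. by rewrite relfree_eval_pi peval_var. Qed.

End Eval.
End RelfreeEval.

(** * Two constructions of algebras in the variety L *)
Definition null_alg (K : fieldType) (W : lmodType K) : Type := W.

Section NullAlg.
Variables (K : fieldType) (W : lmodType K).

HB.instance Definition _ := GRing.Lmodule.on (null_alg W).

Definition null_mul (u v : null_alg W) : null_alg W := 0.

Fact null_mulDl u v w : null_mul (u + v) w = null_mul u w + null_mul v w.
Proof. by rewrite /null_mul addr0. Qed.
Fact null_mulDr u v w : null_mul u (v + w) = null_mul u v + null_mul u w.
Proof. by rewrite /null_mul addr0. Qed.
Fact null_mulZl a u v : null_mul (a *: u) v = a *: null_mul u v.
Proof. by rewrite /null_mul scaler0. Qed.
Fact null_mulZr a u v : null_mul u (a *: v) = a *: null_mul u v.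
Proof. by rewrite /null_mul scaler0. Qed.

HB.instance Definition _ := Lmodule_isNaAlg.Build K (null_alg W)
  null_mulDl null_mulDr null_mulZl null_mulZr.

Lemma null_alg_L : variety_L (null_alg W : naAlgType K).
Proof. by apply/variety_LP; split=> //; apply/variety_RP. Qed.

End NullAlg.

(** An extension of A by an ideal of square zero, twisted by lam: a
    homomorphism from A to it of the form f |-> (f, D f) is the same as a linear
    map D with D (f g) = (D f) g + lam(g) f, the product rule of a partial
    derivative in an algebra where only the linear part of g matters. *)
Definition jet_alg (K : fieldType) (A : naAlgType K) (lam : {scalar A}) : Type :=
  (A * A)%type.

Section JetAlg.
Variables (K : fieldType) (A : naAlgType K) (lam : {scalar A}).
Local Notation J := (jet_alg lam).

HB.instance Definition _ := GRing.Lmodule.on J.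

Definition jet_mul (u v : J) : J := (u.1 ** v.1, u.2 ** v.1 + lam v.1 *: u.1).

Fact jet_mulDl u v w : jet_mul (u + v) w = jet_mul u w + jet_mul v w.
Proof. by congr pair; rewrite /= ?namulDl // scalerDr addrACA. Qed.
Fact jet_mulDr u v w : jet_mul u (v + w) = jet_mul u v + jet_mul u w.
Proof. by congr pair; rewrite /= ?namulDr // linearD scalerDl addrACA. Qed.
Fact jet_mulZl a u v : jet_mul (a *: u) v = a *: jet_mul u v.
Proof. by congr pair; rewrite /= ?namulZl // scalerDr !scalerA mulrC. Qed.
Fact jet_mulZr a u v : jet_mul u (a *: v) = a *: jet_mul u v.
Proof. by congr pair; rewrite /= ?namulZr // linearZ /= scalerDr scalerA. Qed.

HB.instance Definition _ := Lmodule_isNaAlg.Build K J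
  jet_mulDl jet_mulDr jet_mulZl jet_mulZr.

Lemma jet_alg_L : variety_L A -> (forall a b, lam (a ** b) = 0) ->
  variety_L (J : naAlgType K).
Proof.
move=> /variety_LP[/variety_RP RA NA] lam0.
have NJ (u v w : J) : u ** (v ** w) = 0.
  by congr pair; rewrite /= !NA // lam0 scale0r addr0.
apply/variety_LP; split=> //; apply/variety_RP => u v w.
have C a b c : a ** b ** c = a ** c ** b :> A.
  by apply: oppr_inj; have := RA a b c; rewrite /associator !NA !sub0r.
rewrite /associator !NJ !sub0r; congr (- _); congr pair => /=; first exact: C.
rewrite !namulDl !namulZl (C u.2) -!addrA; congr (_ + _); exact: addrC.
Qed.

End JetAlg.

(** * The action of GL_d on relatively free algebras *)
Section GLAction.
Variables (K : fieldType) (d : nat) (V : naAlgType K -> Prop) (g : 'M[K]_d).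
Local Notation F := (relfree V 'I_d).
Local Notation act := (@GL_act K d V g).

HB.instance Definition _ := GRing.isLinear.Build K F F *:%R act
  (relfree_subst_is_linear (GL_vect (@relfree_var K V 'I_d) g)).

Lemma GL_act_var i : act (relfree_var V i) = GL_vect (@relfree_var K V 'I_d) g i.
Proof. exact: relfree_subst_var. Qed.

Lemma GL_actD f h : act (f + h) = act f + act h.
Proof. exact: linearD. Qed.

Lemma GL_actZ a f : act (a *: f) = a *: act f.
Proof. exact: linearZ. Qed.

Lemma GL_actMul f h : act (f ** h) = act f ** act h.
Proof. exact: relfree_substM. Qed.

End GLAction.

Lemma invariants_gen (K : fieldType) (d : nat) (G : 'M[K]_d -> Prop)
    (V : naAlgType K -> Prop) (S : relfree V 'I_d -> Prop) :
  (forall f, S f -> invariants G f) ->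
  forall f, na_subalg_gen S f -> invariants G f.
Proof.
move=> SG f; elim=> {f} [f /SG //||f h _ If _ Ih|a f _ If|f h _ If _ Ih] g Gg.
- by rewrite linear0.
- by rewrite linearD /= If // Ih.
- by rewrite linearZ /= If.
- by rewrite GL_actMul If // Ih.
Qed.

(** * Linear parts, partial derivatives and Taylor expansion in F_d(L) *)
Section FreeL.
Variables (K : fieldType) (d : nat).
Local Notation L := (@variety_L K).
Local Notation F := (relfree L 'I_d).
Local Notation x := (@relfree_var K L 'I_d).

Lemma relfree_L : L F.
Proof. by apply: relfree_variety; exact: variety_of_is_variety. Qed.

Lemma mul_square_eq0 (f g h : F) : f ** (g ** h) = 0.
Proof. by have /variety_LP[_] := relfree_L; apply. Qed.

Lemma rmulAC (f g h : F) : f ** g ** h = f ** h ** g.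
Proof.
have /variety_LP[/variety_RP RF _] := relfree_L.
by apply: oppr_inj; have := RF f g h; rewrite /associator !mul_square_eq0 !sub0r.
Qed.

(** The linear coefficients are read off in the algebra K^d with zero product,
    so that no basis of F_d(L) is needed. *)
Definition lcoef (i : 'I_d) (f : F) : K :=
  (relfree_eval (@null_alg_L K 'rV_d) (fun j => 'e_j : 'rV_d) f : 'rV_d) 0 i.

Lemma lcoef_is_linear i : scalar (lcoef i).
Proof. by move=> a f g; rewrite /lcoef linearP !mxE. Qed.
HB.instance Definition _ i := GRing.isLinear.Build K F K *%R (lcoef i) (lcoef_is_linear i).

Lemma lcoef_var i j : lcoef i (x j) = (i == j)%:R.
Proof. by rewrite /lcoef relfree_eval_var mxE eqxx. Qed.

Lemma lcoefM i f g : lcoef i (f ** g) = 0.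
Proof. by rewrite /lcoef relfree_evalM mxE. Qed.

Definition lpart (f : F) : F := \sum_i lcoef i f *: x i.

Lemma lpart_is_linear : linear lpart.
Proof.
move=> a f g; rewrite /lpart scaler_sumr -big_split; apply: eq_bigr => i _ /=.
by rewrite linearP scalerDl scalerA.
Qed.
HB.instance Definition _ := GRing.isLinear.Build K F F *:%R lpart lpart_is_linear.

Lemma lpartM f g : lpart (f ** g) = 0.
Proof. by rewrite /lpart big1 // => i _; rewrite lcoefM scale0r. Qed.

Lemma lpart_var i : lpart (x i) = x i.
Proof.
rewrite /lpart (bigD1 i) //= lcoef_var eqxx scale1r big1 ?addr0 // => j /negPf ij.
by rewrite lcoef_var ij scale0r.
Qed.

Lemma na_square_sub_lpart f : na_square (f - lpart f).
Proof.
elim/relfree_ind: f => [i||f g [s es] [t et]|a f [s es]|f g _ _].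
- by exists [::]; rewrite lpart_var subrr big_nil.
- by exists [::]; rewrite linear0 subrr big_nil.
- by exists (s ++ t); rewrite big_cat /= -es -et linearD /= opprD addrACA.
- exists [seq (a *: ab.1, ab.2) | ab <- s]; rewrite big_map linearZ /= -scalerBr es.
  by rewrite scaler_sumr; apply: eq_bigr => ab _; rewrite namulZl.
- by exists [:: (f, g)]; rewrite big_seq1 lpartM subr0.
Qed.

Lemma lpart_na_square f : na_square f -> lpart f = 0.
Proof. by case=> s ->; rewrite linear_sum big1 // => ab _; exact: lpartM. Qed.

(** The two sides differ by f times a sum of products, and f (g h) = 0 in L. *)
Lemma mul_lpart f g : f ** g = f ** lpart g.
Proof.
apply/eqP; rewrite -subr_eq0 -namulBr; have [s ->] := na_square_sub_lpart g.
by rewrite namul_sumr big1 // => ab _; rewrite mul_square_eq0.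
Qed.

(** The partial derivative x_p X^m |-> x_p (d X^m / d x_i) on left-normed
    monomials, obtained from the universal property through its product rule. *)
Definition lder (i : 'I_d) (f : F) : F :=
  (relfree_eval (jet_alg_L relfree_L (lcoefM i))
     (fun j => (x j, 0) : jet_alg (lcoef i)) f).2.

Lemma lder_is_linear i : linear (lder i).
Proof. by move=> a f g; rewrite /lder linearP. Qed.
HB.instance Definition _ i := GRing.isLinear.Build K F F *:%R (lder i) (lder_is_linear i).

Lemma lder_var i j : lder i (x j) = 0.
Proof. by rewrite /lder relfree_eval_var. Qed.

Lemma lderM i f g : lder i (f ** g) = lder i f ** g + lcoef i g *: f.
Proof.
have fstE h : (relfree_eval (jet_alg_L relfree_L (lcoefM i))
    (fun j => (x j, 0) : jet_alg (lcoef i)) h).1 = h.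
  elim/relfree_ind: h => [j||u v eu ev|a u eu|u v eu ev].
  - by rewrite relfree_eval_var.
  - by rewrite linear0.
  - by rewrite linearD /= eu ev.
  - by rewrite linearZ /= eu.
  - by rewrite relfree_evalM /= eu ev.
by rewrite /lder relfree_evalM /= !fstE.
Qed.

Lemma lcoef_GL i g f : lcoef i (GL_act g f) = \sum_j g i j * lcoef j f.
Proof.
elim/relfree_ind: f => [k||u v eu ev|a u eu|u v _ _].
- rewrite GL_act_var /GL_vect linear_sum (bigD1 i) //= [RHS](bigD1 k) //=.
  rewrite !big1 => [|j /negPf kj|j]; last 2 first.
  - by rewrite lcoef_var kj mulr0.
  - by rewrite eq_sym => /negPf ij; rewrite linearZ /= lcoef_var ij mulr0.
  by rewrite linearZ /= !lcoef_var !eqxx.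
- by rewrite linear0 linear0 big1 // => j _; rewrite linear0 mulr0.
- rewrite !linearD /= eu ev -big_split; apply: eq_bigr => j _.
  by rewrite linearD mulrDr.
- rewrite !linearZ /= eu mulr_sumr; apply: eq_bigr => j _.
  by rewrite linearZ /= mulrCA.
- by rewrite GL_actMul lcoefM big1 // => j _; rewrite lcoefM mulr0.
Qed.

Lemma lpart_GL g f : lpart (GL_act g f) = GL_act g (lpart f).
Proof.
rewrite /lpart linear_sum.
under eq_bigr => i _ do rewrite lcoef_GL scaler_suml.
rewrite exchange_big; apply: eq_bigr => j _.
rewrite linearZ /= GL_act_var /GL_vect scaler_sumr.
by apply: eq_bigr => i _; rewrite scalerA mulrC.
Qed.

(** The chain rule for the substitution of sum_i g_ij x_i for x_j. *)
Lemma lder_GL i g f : lder i (GL_act g f) = \sum_j g i j *: GL_act g (lder j f).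
Proof.
elim/relfree_ind: f => [k||u v eu ev|a u eu|u v eu _].
- rewrite GL_act_var /GL_vect linear_sum !big1 // => j _.
    by rewrite lder_var linear0 scaler0.
  by rewrite linearZ /= lder_var scaler0.
- by rewrite linear0 linear0 big1 // => j _; rewrite !linear0.
- rewrite !linearD /= eu ev -big_split; apply: eq_bigr => j _.
  by rewrite [lder j (u + v)]linearD GL_actD scalerDr.
- rewrite !linearZ /= eu scaler_sumr; apply: eq_bigr => j _.
  by rewrite [lder j (a *: u)]linearZ GL_actZ !scalerA mulrC.
- rewrite GL_actMul lderM eu lcoef_GL namul_suml scaler_suml -big_split.
  apply: eq_bigr => j _ /=.
  by rewrite lderM GL_actD GL_actZ GL_actMul namulZl scalerDr scalerA.
Qed.

Section Taylor.
Variable A : naAlgType K.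
Implicit Type y : 'I_d -> A.

(** The component of degree n + 1 of f, with the letters after the first
    symmetrised, evaluated at y in A. It equals
    1/n! * sum over i_1, ..., i_n of the linear part of D_{i_n} ... D_{i_1} f
    evaluated at y and multiplied on the right by y_{i_n}, ..., y_{i_1}. *)
Fixpoint taylor y (n : nat) (f : F) : A :=
  if n is m.+1 then m.+1%:R^-1 *: \sum_i taylor y m (lder i f) ** y i
  else \sum_i lcoef i f *: y i.

Lemma taylor_is_linear y n : linear (taylor y n).
Proof.
elim: n => [|n IH] a f g /=.
  rewrite scaler_sumr -big_split; apply: eq_bigr => i _ /=.
  by rewrite linearP scalerDl scalerA.
rewrite scalerA [a * _]mulrC -scalerA -scalerDr; congr (_ *: _).
rewrite scaler_sumr -big_split.
by apply: eq_bigr => i _ /=; rewrite linearP IH namulDl namulZl.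
Qed.
HB.instance Definition _ y n :=
  GRing.isLinear.Build K F A *:%R (taylor y n) (taylor_is_linear y n).

(** The operator sum_i D_i (x) y_i does not depend on the choice of
    coordinates, so acting on f amounts to acting on the point y. *)
Lemma taylor_GL y n g f : taylor y n (GL_act g f) = taylor (GL_vect y g) n f.
Proof.
elim: n f => [|n IH] f /=.
  under eq_bigr => i _ do rewrite lcoef_GL scaler_suml.
  rewrite exchange_big; apply: eq_bigr => j _; rewrite scaler_sumr.
  by apply: eq_bigr => i _; rewrite scalerA mulrC.
congr (_ *: _).
under eq_bigr => i _ do rewrite lder_GL linear_sum namul_suml.
rewrite exchange_big; apply: eq_bigr => j _; rewrite namul_sumr.
by apply: eq_bigr => i _; rewrite linearZ /= IH namulZl namulZr.
Qed.

End Taylor.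

Lemma taylor_hom (A B : naAlgType K) (k : {linear A -> B})
    (kM : forall a b, k (a ** b) = k a ** k b) (y : 'I_d -> A) z :
  (forall i, k (y i) = z i) ->
  forall n f, k (taylor y n f) = taylor z n f.
Proof.
move=> kyz; elim=> [|n IH] f /=.
  by rewrite linear_sum; apply: eq_bigr => i _; rewrite linearZ /= kyz.
rewrite linearZ linear_sum; congr (_ *: _); apply: eq_bigr => i _.
by rewrite kM IH kyz.
Qed.

Section Char0.
Hypothesis charK : [pchar K] =i pred0.

Fact natSr_neq0 n : n.+1%:R != 0 :> K.
Proof. by move/pcharf0P: charK => ->. Qed.

(** Euler's formula. Differentiating the last factor x_j gives the right-hand
    side once, and differentiating f gives it n times by the induction
    hypothesis and by the commutation of right multiplications; the
    factor (n + 1)^-1 compensates for this. *)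
Lemma taylor_rmul n f j : taylor x n.+1 (f ** x j) = taylor x n f ** x j.
Proof.
have E m h : m.+1%:R *: taylor x m.+1 h = \sum_i taylor x m (lder i h) ** x i.
  by rewrite /= scalerA divff ?scale1r ?natSr_neq0.
have T0M h k : taylor x 0 (h ** k) = 0 by exact: lpartM.
have TD m h k : taylor x m (h + k) = taylor x m h + taylor x m k by exact: linearD.
have TZ m a h : taylor x m (a *: h) = a *: taylor x m h by exact: linearZ.
(* From here on only these four properties of the expansion at x matter. *)
move: (taylor x) E T0M TD TZ => T E T0M TD TZ.
have DM i h : lder i (h ** x j) = lder i h ** x j + (i == j)%:R *: h.
  by rewrite lderM lcoef_var.
apply: (@scalerI _ _ n.+1%:R); first exact: natSr_neq0.
rewrite E; elim: n f => [|n IH] f.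
  rewrite scale1r (bigD1 j) // DM eqxx scale1r TD T0M add0r.
  rewrite big1 => [|i /negPf ij]; first exact: addr0.
  by rewrite DM ij scale0r addr0 T0M namul0l.
(* The product rule, with the induction hypothesis applied to lder i f. *)
transitivity (\sum_i (T n (lder i f) ** x j ** x i +
                      (i == j)%:R *: (T n.+1 f ** x i))).
  apply: eq_bigr => i _; rewrite DM TD TZ namulDl namulZl.
  congr (_ ** _ + _); apply: (@scalerI _ _ n.+1%:R); first exact: natSr_neq0.
  by rewrite E IH.
rewrite big_split /= [X in _ + X](bigD1 j) //= eqxx scale1r.
rewrite [X in _ + (_ + X)]big1 => [|i /negPf ->]; last by rewrite scale0r.
under eq_bigr => i _ do rewrite rmulAC.
by rewrite -namul_suml -E namulZl addr0 [in RHS]mulrSr scalerDl scale1r.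
Qed.

(** The two cases that matter are the variables, of which only the term of
    index 0 survives, and right multiplication by a variable, which shifts the
    expansion by one (taylor_rmul). Products reduce to the latter by mul_lpart. *)
Lemma taylor_sum f : exists n, \sum_(i < n) taylor x i f = f.
Proof.
(* The induction needs all large bounds, so that two elements can share one. *)
suff [n nP] : exists n, forall m, (n <= m)%N -> \sum_(i < m) taylor x i f = f.
  by exists n; exact: nP.
elim/relfree_ind: f => [i||f g [n nP] [m mP]|a f [n nP]|f g [n nP] _].
- exists 1%N => -[|m] // _; rewrite big_ord_recl /= -/(lpart (x i)) lpart_var.
  rewrite big1 ?addr0 // => k _ /=; rewrite big1 ?scaler0 // => j _.
  by rewrite lder_var linear0 namul0l.
- by exists 0%N => m _; rewrite big1 // => i _; rewrite linear0.
- exists (maxn n m) => k; rewrite geq_max => /andP[/nP ef /mP eg].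
  by rewrite -[in RHS]ef -[in RHS]eg -big_split; apply: eq_bigr => i _; rewrite linearD.
- exists n => m /nP ef; rewrite -[in RHS]ef scaler_sumr.
  by apply: eq_bigr => i _; rewrite linearZ.
- exists n.+1 => -[|m] //; rewrite ltnS => /nP ef.
  rewrite mul_lpart namul_sumr.
  under eq_bigr => k _ do rewrite linear_sum.
  rewrite exchange_big; apply: eq_bigr => j _.
  under eq_bigr => k _ do rewrite namulZr linearZ /=.
  rewrite -scaler_sumr namulZr; congr (_ *: _).
  rewrite big_ord_recl /= big1 ?add0r => [|i _]; last by rewrite lcoefM scale0r.
  by rewrite -{2}ef namul_suml; apply: eq_bigr => k _; rewrite -taylor_rmul.
Qed.

End Char0.

End FreeL.

(** * Lifting invariants along F_d(V) -> F_d(L) *)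
Section Lifting.
Variables (K : fieldType) (d : nat) (V : naAlgType K -> Prop).
Hypothesis charK : [pchar K] =i pred0.
Hypothesis L_sub_V : forall A : naAlgType K, variety_L A -> V A.
Variable G : 'M[K]_d -> Prop.
Local Notation FV := (relfree V 'I_d).
Local Notation FL := (relfree (@variety_L K) 'I_d).

Definition relfree_toL : FV -> FL :=
  relfree_eval (L_sub_V (@relfree_L K d)) (@relfree_var K _ 'I_d).
HB.instance Definition _ := GRing.Linear.on relfree_toL.

Lemma relfree_toLD f h : relfree_toL (f + h) = relfree_toL f + relfree_toL h.
Proof. exact: linearD. Qed.

Lemma relfree_toLZ a f : relfree_toL (a *: f) = a *: relfree_toL f.
Proof. exact: linearZ. Qed.

Lemma relfree_toLM f h : relfree_toL (f ** h) = relfree_toL f ** relfree_toL h.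
Proof. exact: relfree_evalM. Qed.

Lemma relfree_toL_var i : relfree_toL (relfree_var V i) = relfree_var _ i.
Proof. exact: relfree_eval_var. Qed.

Lemma relfree_toL_GL g f : relfree_toL (GL_act g f) = GL_act g (relfree_toL f).
Proof.
elim/relfree_ind: f => [i||f h ef eh|a f ef|f h ef eh].
- rewrite relfree_toL_var !GL_act_var /GL_vect linear_sum.
  by apply: eq_bigr => j _; rewrite linearZ /= relfree_toL_var.
- by rewrite !linear0.
- by rewrite GL_actD relfree_toLD ef eh -GL_actD -relfree_toLD.
- rewrite (GL_actZ g a f) [LHS]relfree_toLZ [in LHS]ef -[LHS]GL_actZ.
  by congr GL_act; exact/esym/relfree_toLZ.
- by rewrite GL_actMul !relfree_toLM GL_actMul ef eh.
Qed.

Lemma invariants_toL f : invariants G f -> invariants G (relfree_toL f).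
Proof. by move=> If g Gg; rewrite -relfree_toL_GL If. Qed.

(** The Taylor expansion of f evaluated at the variables of F_d(V) is invariant
    because an element g moves it to the expansion of g f = f, and maps to the
    expansion of f in F_d(L), which is f. *)
Lemma invariants_lift f : invariants G f ->
  exists2 h, invariants G h & relfree_toL h = f.
Proof.
move=> If; have [n ef] := taylor_sum charK f.
exists (\sum_(i < n) taylor (@relfree_var K V 'I_d) i f); last first.
  rewrite linear_sum -[RHS]ef; apply: eq_bigr => i _.
  by apply: taylor_hom; [exact: relfree_toLM | exact: relfree_toL_var].
move=> g Gg; rewrite linear_sum; apply: eq_bigr => i _.
rewrite -[in RHS](If g Gg) taylor_GL.
by apply: taylor_hom; [exact: GL_actMul | exact: GL_act_var].
Qed.

Lemma fg_invariants_L : fg_algebra (@invariants K d G V) ->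
  fg_algebra (@invariants K d G (@variety_L K)).
Proof.
case=> s sP; exists (map relfree_toL s) => f; split=> [If|].
  have [h /sP gen_h <-] := invariants_lift If.
  elim: gen_h => {h} [h hs||h k _ Hh _ Hk|a h _ Hh|h k _ Hh _ Hk].
  - by apply: na_gen_in; apply: map_f.
  - by rewrite linear0; exact: na_gen_0.
  - by rewrite linearD; exact: na_gen_D.
  - by rewrite linearZ; exact: na_gen_Z.
  - by rewrite relfree_toLM; exact: na_gen_M.
apply: invariants_gen => _ /mapP[h hs ->].
by apply: invariants_toL; apply/sP; exact: na_gen_in.
Qed.

End Lifting.

(** * From algebra generators to module generators in F_d(L) *)
Section SquareModule.
Variables (K : fieldType) (d : nat).
Local Notation F := (relfree (@variety_L K) 'I_d).
Local Notation x := (@relfree_var K (@variety_L K) 'I_d).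

HB.instance Definition _ (f : F) :=
  GRing.isLinear.Build K {mpoly K[d]} F *:%R (ract f) (@ract_linear K d f).

Lemma rmul_monomU (f : F) i : rmul_monom f U_(i)%MM = f ** x i.
Proof.
have H (s : seq 'I_d) h : uniq s ->
    foldl (fun h j => iter (U_(i)%MM j) (fun h' => h' ** x j) h) h s =
    if i \in s then h ** x i else h.
  elim: s h => //= j s IH h /andP[js us]; rewrite IH // mnmE inE.
  by have [->|_] //= := eqVneq i j; rewrite (negPf js).
by rewrite /rmul_monom H ?enum_uniq // mem_enum.
Qed.

Lemma ract1 (f : F) : ract f 1 = f.
Proof.
rewrite -mpolyX0 ractX /rmul_monom; elim: (enum 'I_d) => //= i s IH.
by rewrite mnmE.
Qed.

Lemma ractMX (f : F) p i : ract f (p * 'X_i) = ract f p ** x i.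
Proof.
rewrite [p]mpolyE mulr_suml !linear_sum namul_suml; apply: eq_bigr => m _ /=.
by rewrite -scalerAl !linearZ namulZl /= -mpolyXD !ractX -rmul_monomD rmul_monomU.
Qed.

(** The linear part of f as a polynomial: right multiplication by f is the
    action of this linear form. *)
Definition lform (f : F) : {mpoly K[d]} := \sum_i lcoef i f *: 'X_i.

Lemma ractM_lform (f h : F) p : ract f (p * lform h) = ract f p ** h.
Proof.
rewrite mul_lpart /lform mulr_sumr linear_sum namul_sumr; apply: eq_bigr => i _.
by rewrite -scalerAr linearZ namulZr /= ractMX.
Qed.

Variable G : 'M[K]_d -> Prop.

Lemma lform_invariant f : invariants G f -> linear_invariants G (lform f).
Proof.
move=> If; split.
  by apply: rpred_sum => i _; rewrite dhomogZ // dhomogX /= mdeg1.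
move=> g Gg; rewrite -[in RHS](If g Gg) /GL_act_poly /lform linear_sum.
under [RHS]eq_bigr => i _ do rewrite lcoef_GL scaler_suml.
rewrite [RHS]exchange_big; apply: eq_bigr => j _.
rewrite linearZ /= comp_mpolyXU -tnth_nth tnth_mktuple /GL_vect scaler_sumr.
by apply: eq_bigr => i _; rewrite scalerA mulrC.
Qed.

Definition in_module (s : seq F) (f : F) : Prop :=
  exists p : 'I_(size s) -> {mpoly K[d]},
    (forall i, linear_invariant_alg G (p i)) /\ f = \sum_(i < size s) ract s`_i (p i).

Lemma lia_0 : linear_invariant_alg G 0.
Proof. by rewrite -(scale0r 1); apply: lia_Z; exact: lia_1. Qed.

Lemma in_module0 s : in_module s 0.
Proof.
exists (fun=> 0); split=> [_|]; first exact: lia_0.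
by rewrite big1 // => i _; rewrite linear0.
Qed.

Lemma in_moduleD s f h : in_module s f -> in_module s h -> in_module s (f + h).
Proof.
move=> [p [Bp ->]] [q [Bq ->]]; exists (fun i => p i + q i); split=> [i|].
  exact: lia_D.
by rewrite -big_split; apply: eq_bigr => i _; rewrite linearD.
Qed.

Lemma in_moduleZ s a f : in_module s f -> in_module s (a *: f).
Proof.
move=> [p [Bp ->]]; exists (fun i => a *: p i); split=> [i|]; first exact: lia_Z.
by rewrite scaler_sumr; apply: eq_bigr => i _; rewrite linearZ.
Qed.

Lemma in_module_mem s f : f \in s -> in_module s f.
Proof.
move=> fs; have lt_f : (index f s < size s)%N by rewrite index_mem.
exists (fun i => (i == Ordinal lt_f)%:R); split=> [i|].
  by case: (_ == _); [exact: lia_1 | exact: lia_0].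
rewrite (bigD1 (Ordinal lt_f)) //= eqxx big1 ?addr0 => [|i /negPf ->].
  by rewrite nth_index // ract1.
by rewrite linear0.
Qed.

Lemma in_module_rmul s f h : invariants G h -> in_module s f -> in_module s (f ** h).
Proof.
move=> Ih [p [Bp ->]]; exists (fun i => p i * lform h); split=> [i|].
  by apply: lia_M => //; apply: lia_in; exact: lform_invariant.
by rewrite namul_suml; apply: eq_bigr => i _; rewrite ractM_lform.
Qed.

(** Induction over the generated subalgebra, carrying two claims about f: that
    f minus its linear part lies in the module, and that so does f k for every
    k of the subalgebra. The second claim gives the first for products. For a
    generator f the second is an induction over k in which f k = 0 when k is a
    product; for a product f it holds since k acts by an invariant linear
    form. *)
Lemma fg_square_invariants : fg_algebra (@invariants K d G (@variety_L K)) ->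
  fg_module (linear_invariant_alg G) (@square_invariants K d G (@variety_L K)).
Proof.
case=> t tP.
have It f : f \in t -> invariants G f by move=> ft; apply/tP; exact: na_gen_in.
pose s := [seq f - lpart f | f <- t] ++ [seq f ** h | f <- t, h <- t].
exists s; split=> [f|f [f2 /tP gen_f]].
  rewrite mem_cat => /orP[/mapP[h /It Ih ->]|/allpairsP[[h k] [/It Ih /It Ik ->]]].
    split; first exact: na_square_sub_lpart.
    by move=> g Gg; rewrite linearB /= -lpart_GL Ih.
  split; first by exists [:: (h, k)]; rewrite big_seq1.
  by move=> g Gg; rewrite GL_actMul Ih ?Ik.
have gen_inv h : na_subalg_gen (fun k => k \in t) h -> invariants G h.
  by move/tP.
have t_rmul h k : h \in t -> na_subalg_gen (fun k => k \in t) k ->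
    in_module s (h ** k).
  move=> ht; elim=> {k} [k kt||k l _ Hk _ Hl|a k _ Hk|k l _ _ _ _].
  - by apply: in_module_mem; rewrite mem_cat orbC allpairs_f.
  - by rewrite namul0r; exact: in_module0.
  - by rewrite namulDr; exact: in_moduleD.
  - by rewrite namulZr; exact: in_moduleZ.
  - by rewrite mul_square_eq0; exact: in_module0.
suff [] : in_module s (f - lpart f) /\
    forall k, na_subalg_gen (fun k => k \in t) k -> in_module s (f ** k).
  by rewrite lpart_na_square ?subr0.
elim: gen_f {f2} => {f} [f ft||f h _ [Mf fM] _ [Mh hM]|a f _ [Mf fM]|f h _ [_ fM] gh _].
- split=> [|k]; last exact: t_rmul.
  by apply: in_module_mem; rewrite mem_cat; apply/orP; left; apply/mapP; exists f.
- split=> [|k _]; last by rewrite namul0l; exact: in_module0.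
  by rewrite linear0 subr0; exact: in_module0.
- split=> [|k gk]; last by rewrite namulDl; apply: in_moduleD; auto.
  by rewrite [lpart _]linearD opprD addrACA; exact: (in_moduleD Mf Mh).
- split=> [|k gk]; last by rewrite namulZl; apply: in_moduleZ; auto.
  by rewrite [lpart _]linearZ -scalerBr; exact: (in_moduleZ a Mf).
- rewrite lpartM subr0; split=> [|k gk]; first exact: fM.
  by apply: in_module_rmul; [exact: gen_inv | exact: fM].
Qed.

End SquareModule.

Theorem theorem2p2 (K : fieldType) (charK : [pchar K] =i pred0)
  (d : nat) (d_ge2 : (2 <= d)%N)
  (V : naAlgType K -> Prop) (V_variety : is_variety V)
  (V_sub_R : forall A : naAlgType K, V A -> variety_R A)
  (L_sub_V : forall A : naAlgType K, variety_L A -> V A)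
  (G : 'M[K]_d -> Prop) (G_subgroup : GL_subgroup G)
  (G_nontrivial : exists2 g : 'M[K]_d, G g & g <> 1%:M)
  (not_fg_square : ~ fg_module (linear_invariant_alg G)
                       (@square_invariants K d G (@variety_L K))) :
  ~ fg_algebra (@invariants K d G V).
Proof.
by move=> /(fg_invariants_L charK L_sub_V) /fg_square_invariants.
Qed.
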